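(* Let $g_i:\mathbb{R}\to\mathbb{R}$ be convex functions for $i\in[n]$, let $m,h\in\mathbb{R}^n$, $r,q\in\mathbb{R}$, and $\gamma\in\mathbb{R}_+$. Let $a_1,\dots,a_n\in\mathbb{R}^n$ be such that $a_n\ne0$ and $a_i\perp a_j$ for all $i\neq j$, and let $\alpha_1,\dots,\alpha_n\in\mathbb{R}_+$ be such that $\alpha_n\neq0$ and $\alpha_n\ge\alpha_i$ for all $i$. Let $$G(x)=\sum_{i=1}^ng_i(a_i^Tx)+m^Tx+r,\qquad J(x)=-\sum_{i=1}^n\alpha_ig_i(a_i^Tx)-h^Tx-q,$$ $B=\mathrm{epi}(G)$, and $F=\{(x,t)\in\mathbb{R}^{n+1}:\gamma t\le J(x)\}$. If $1+\gamma/\alpha_n>0$ and $$\lim_{|s|\to\infty}\;-\alpha_ng_n(s\,a_n^Ta_n)-s\Bigl(h^Ta_n+\gamma\,\frac{(m-h/\alpha_n)^Ta_n}{1+\gamma/\alpha_n}\Bigr)=-\infty,$$ then $$\mathrm{conv}\bigl(B\setminus \mathrm{int}(F)\bigr)=\mathrm{conv}\bigl(\{(x,t)\in\mathrm{epi}(G):J(x)\le\gamma t\}\bigr)=\mathrm{epi}(G)\cap\mathrm{epi}(W),$$ where $$W(x)=\frac{G(x)+(1/\alpha_n)J(x)}{1+\gamma/\alpha_n}=\frac{\sum_{i=1}^{n-1}(1-\alpha_i/\alpha_n)g_i(a_i^Tx)+(m-h/\alpha_n)^Tx+(r-q/\alpha_n)}{1+\gamma/\alpha_n}.$$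
   Context: $[n]=\{1,\dots,n\}$, $\mathbb{R}_+$ is the set of nonnegative reals, and $\mathrm{epi}(G)=\{(x,t)\in\mathbb{R}^{n+1}:G(x)\le t\}$. $\mathrm{int}$ is the topological interior and $\mathrm{conv}$ the convex hull. *)

(* Defs.v *)
From mathcomp Require Export all_boot all_order all_algebra.
From mathcomp Require Export all_classical all_reals all_analysis.
Export Order.TTheory GRing.Theory Num.Theory.
Export numFieldNormedType.Exports.

Set Implicit Arguments.
Unset Strict Implicit.
Unset Printing Implicit Defensive.

Local Open Scope classical_set_scope.
Local Open Scope ring_scope.

Definition dot {R : realType} {n : nat} (u v : 'cV[R]_n) : R :=
  (u^T *m v) ord0 ord0.

Definition epi {R : realType} {n : nat} (f : 'cV[R]_n -> R) :
    set ('cV[R]_n * R^o)%type :=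
  [set p | f p.1 <= p.2].

Definition convex_hull {R : realType} {M : lmodType R} (A : set M) : set M :=
  smallest (@convex_set R M) A.

(* The filter of neighbourhoods of infinity for |s| on the real line. *)
Definition norm_pinfty_nbhs (R : realType) : set_system R :=
  filter_from setT (fun M : R => [set s : R | M < `|s|]).

Arguments norm_pinfty_nbhs R : clear implicits.

Global Instance norm_pinfty_nbhs_filter (R : realType) :
  ProperFilter (norm_pinfty_nbhs R).
Proof.
apply: filter_from_proper; last first.
  move=> M _; exists (`|M| + 1); rewrite /= ger0_norm ?addr_ge0//.
  by rewrite (le_lt_trans (ler_norm M))// ltrDl.
apply: filter_from_filter; first by exists 0.
move=> M N _ _; exists (Num.max M N) => // s /=.
by rewrite gt_max => /andP[].
Qed.

(* Main.v *)
Require Import Defs.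
From mathcomp Require Import ring lra.

(** W is affine along a_n, say with slope c, and the limit hypothesis says that
    J(x) - gamma t tends to -oo along the line p + s (a_n, c) in both
    directions. A point p of epi(G) and epi(W) lying in int(F) therefore leaves
    int(F) in both directions along this line. At the two exit points p1, p2 we
    have gamma t <= J(x) since F is closed, and W(x) <= t since W is affine with
    slope c; together these give G(x) <= t. Hence p lies between two points of
    epi(G) \ int(F). Using exit points from int(F), rather than points where
    J(x) = gamma t, also covers the degenerate case gamma = 0, max J = 0, where
    int(F) can contain points with J(x) = 0. *)

Set Implicit Arguments.
Unset Strict Implicit.
Unset Printing Implicit Defensive.

Local Open Scope classical_set_scope.
Local Open Scope ring_scope.

(** * Dot product and elementary continuity facts *)

Lemma dotE (R : realType) (n : nat) (u v : 'cV[R]_n) :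
  dot u v = \sum_(i < n) u i ord0 * v i ord0.
Proof. by rewrite /dot mxE; apply: eq_bigr => i _; rewrite mxE. Qed.

Lemma dotDr (R : realType) (n : nat) (u v w : 'cV[R]_n) :
  dot u (v + w) = dot u v + dot u w.
Proof. by rewrite /dot mulmxDr mxE. Qed.

Lemma dotZr (R : realType) (n : nat) (u v : 'cV[R]_n) (c : R) :
  dot u (c *: v) = c * dot u v.
Proof. by rewrite /dot -scalemxAr mxE. Qed.

Lemma dotBZl (R : realType) (n : nat) (u v w : 'cV[R]_n) (c : R) :
  dot (u - c *: v) w = dot u w - c * dot v w.
Proof. by rewrite /dot linearB linearZ mulmxBl -scalemxAl !mxE. Qed.

Lemma dot_gt0 (R : realType) (n : nat) (u : 'cV[R]_n) : u <> 0 -> 0 < dot u u.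
Proof.
move=> u0; have sq0 i : 0 <= u i ord0 * u i ord0 by rewrite -expr2 sqr_ge0.
rewrite lt_neqAle dotE sumr_ge0 ?andbT//; apply/eqP => /esym/eqP.
rewrite psumr_eq0// => /allP uu0; apply/u0/colP => i; rewrite mxE.
by have := uu0 i (mem_index_enum i); rewrite /= mulf_eq0 orbb => /eqP.
Qed.

Lemma continuous_dot (R : realType) (n : nat) (u : 'cV[R]_n) :
  continuous (dot u).
Proof.
rewrite (_ : dot u = fun v => \sum_(i < n) u i ord0 * v i ord0); last first.
  by apply/funext => v; rewrite dotE.
apply: continuous_big => [|i _ v]; first exact: add_continuous.
apply: (@continuous_comp _ _ _ (fun w : 'cV[R]_n => w i ord0)).
  exact: coord_continuous.
exact: mulrl_continuous.
Qed.

Lemma continuous_subr (R : realType) (T : topologicalType) (f1 f2 : T -> R) :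
  continuous f1 -> continuous f2 -> continuous (fun x => f1 x - f2 x).
Proof. by move=> c1 c2 x; apply: continuousB; [exact: c1 | exact: c2]. Qed.

(** * Convexity inequalities and continuity of convex functions *)

Lemma convex_function_le (R : realType) (E : lmodType R) (f : E -> R^o)
    (t : R) (x y : E) :
  convex_function setT f -> 0 <= t -> t <= 1 ->
  f (t *: x + (1 - t) *: y) <= t * f x + (1 - t) * f y.
Proof. by move=> fc t0 t1; apply: (fc (Itv01 t0 t1)); rewrite in_setT. Qed.

Lemma convex_chord (R : realType) (f : R -> R) (x e t : R) :
  convex_function setT (f : R^o -> R^o) -> 0 <= t -> t <= 1 ->
  f (x + t * e) <= f x + t * (f (x + e) - f x).
Proof.
move=> fc t0 t1.
have : f (t * (x + e) + (1 - t) * x) <= _ :=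
  @convex_function_le R R^o f t (x + e) x fc t0 t1.
rewrite (_ : t * (x + e) + _ = x + t * e); last by ring.
by move=> /le_trans; apply; rewrite le_eqVlt; apply/orP; left; apply/eqP; ring.
Qed.

(** The [g i] are only assumed convex; their continuity makes [J] continuous and so [F] closed.
    Chord bounds give [|f y - f x| <= C * |y - x|] for [|y - x| <= 1]. *)
Lemma convex_continuous (R : realType) (f : R -> R) :
  convex_function setT (f : R^o -> R^o) -> continuous f.
Proof.
move=> fc x; pose C := `|f (x + 1) - f x| + `|f (x - 1) - f x| + 1.
have C0 : 0 < C by rewrite ltr_wpDl// addr_ge0.
(* The chord on one side of [x] bounds [f] from above there; the one through
   the unit step on the other side bounds it from below. *)
have key e t : `|e| = 1 -> 0 <= t -> t <= 1 -> `|f (x + t * e) - f x| <= t * C.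
  move=> e1 t0 t1; have := convex_chord x e fc t0 t1.
  (* The point [x] divides the segment from [x + t * e] to [x - e] in the ratio [t : 1], whence the
     chord parameter [t / (1 + t)]. *)
  have l0 : 0 <= t / (1 + t) by rewrite divr_ge0// addr_ge0.
  have l1 : t / (1 + t) <= 1 by rewrite ler_pdivrMr ?mul1r ?lerDr// ltr_pwDl.
  have := convex_chord (x + t * e) (- (1 + t) * e) fc l0 l1.
  have t1n : 1 + t != 0 by rewrite gt_eqF// ltr_pwDl.
  rewrite (_ : x + t * e + _ * _ = x); last by field.
  rewrite (_ : x + t * e + _ = x - e); last by ring.
  rewrite -(ler_pM2l (_ : 0 < 1 + t)) ?ltr_pwDl//.
  rewrite (_ : (1 + t) * (_ + _) = f (x + t * e) + t * f (x - e)); last by field.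
  have Ce (u : R) : `|u| = 1 -> f (x + u) - f x <= C.
    move=> u1; have uE : u = 1 \/ u = -1.
      by move: u1; case: ger0P => _ <-; [left | right; rewrite opprK].
    have n1 := normr_ge0 (f (x + 1) - f x).
    have n2 := normr_ge0 (f (x - 1) - f x).
    have m1 := ler_norm (f (x + 1) - f x).
    have m2 := ler_norm (f (x - 1) - f x).
    by case: uE => ->; rewrite /C; lra.
  have := ler_wpM2l t0 (Ce e e1).
  have := ler_wpM2l t0 (Ce (- e) _); rewrite normrN => /(_ e1).
  by rewrite ler_norml => *; apply/andP; split; lra.
apply/cvgrPdist_le => eps eps0; near=> y.
have yx1 : `|y - x| <= 1.
  by rewrite distrC; near: y; apply: cvgr_dist_le => //; exact: cvg_id.
have yxe : `|y - x| * C <= eps.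
  rewrite -ler_pdivlMr// distrC; near: y.
  by apply: cvgr_dist_le; [exact: cvg_id | exact: divr_gt0].
rewrite distrC; apply: le_trans yxe.
have [xy|xy] := leP 0 (y - x).
  have := key 1 `|y - x| (normr1 _) (normr_ge0 _) yx1.
  by rewrite mulr1 {1}(ger0_norm xy) subrKC.
have := key (-1) `|y - x| (normrN1 _) (normr_ge0 _) yx1.
by rewrite {1}(ltr0_norm xy) mulrN1 opprK subrKC.
Unshelve. all: by end_near. Qed.

(** * Convexity of [G], of the numerator of [W], and of their epigraphs *)

Lemma convex_affine_sum (R : realType) (n : nat) (I : finType) (P : pred I)
    (c : I -> R) (f : I -> R -> R) (u : I -> 'cV[R]_n) (v : 'cV[R]_n) (k : R) :
  (forall i, P i -> 0 <= c i) ->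
  (forall i, convex_function setT (f i : R^o -> R^o)) ->
  convex_function setT
    (fun x : 'cV[R]_n => \sum_(i | P i) c i * f i (dot (u i) x) + dot v x + k : R^o).
Proof.
move=> c0 fc t x y _ _.
rewrite convRE (_ : conv t x y = t%:num *: x + (1 - t%:num) *: (y : 'cV[R]_n))//.
have [l0 l1] : 0 <= t%:num /\ t%:num <= 1 by [].
move: (t%:num) l0 l1 => l l0 l1; rewrite /unstable.onem.
rewrite [leRHS](_ : _ = \sum_(i | P i) c i * (l * f i (dot (u i) x)
    + (1 - l) * f i (dot (u i) y)) + (l * dot v x + (1 - l) * dot v y) + k).
  apply: lerD => //; apply: lerD; last by rewrite dotDr !dotZr.
  apply: ler_sum => i Pi; apply: ler_wpM2l; first exact: c0.
  rewrite dotDr !dotZr.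
  exact: (@convex_function_le R R^o (f i) l _ _ (fc i) l0 l1).
rewrite [in RHS](eq_bigr (fun i => l * (c i * f i (dot (u i) x))
    + (1 - l) * (c i * f i (dot (u i) y)))); last by move=> i _; ring.
by rewrite big_split/= -!mulr_sumr; ring.
Qed.

Lemma convex_epi_div (R : realType) (n : nat) (f : 'cV[R]_n -> R) (k : R) :
  0 < k -> convex_function setT (f : 'cV[R]_n -> R^o) ->
  convex_set (epi (fun x => f x / k)).
Proof.
move=> k0 fc [x s] [y t] l; rewrite !inE /epi /= !ler_pdivrMr// => fs ft.
apply: le_trans (@convex_function_le R _ f l%:num x y fc _ _) _ => //.
rewrite /= /unstable.onem [leRHS]mulrDl; apply: lerD.
  by rewrite -mulrA; apply: ler_wpM2l.
by rewrite -mulrA; apply: ler_wpM2l => //; rewrite subr_ge0.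
Qed.

Lemma convex_epi (R : realType) (n : nat) (f : 'cV[R]_n -> R) :
  convex_function setT (f : 'cV[R]_n -> R^o) -> convex_set (epi f).
Proof.
move=> /(convex_epi_div (@ltr01 R)).
by under [X in epi X]eq_fun do rewrite divr1.
Qed.

(** * Segments and rays through a point *)

Lemma convex_hull_between (R : realType) (E : lmodType R) (A : set E)
    (p d : E) (s t : R) :
  0 < s -> 0 < t -> A (p + s *: d) -> A (p + t *: - d) -> convex_hull A p.
Proof.
move=> s0 t0 As At C [Cconv AC].
have st0 : 0 < s + t by exact: addr_gt0.
(* With weights [t / (s + t)] and [s / (s + t)] the displacements [s *: d] and [t *: - d] cancel. *)
have l0 : 0 <= t / (s + t) by rewrite divr_ge0// ltW.
have l1 : t / (s + t) <= 1 by rewrite ler_pdivrMr// mul1r lerDr ltW.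
have := Cconv _ _ (Itv01 l0 l1) (mem_set (AC _ As)) (mem_set (AC _ At)).
rewrite inE; congr C; rewrite /conv/= /unstable.onem.
rewrite !scalerDr addrACA -scalerDl subrKC scale1r !scalerA scalerN -scalerBl.
rewrite [X in X *: d](_ : _ = 0) ?scale0r ?addr0//.
by field; rewrite gt_eqF.
Qed.

(** The exit time is the infimum of the times spent outside the interior. Openness of the interior
    keeps the exit point out of it; closedness of [F] keeps the exit point in [F], since all earlier
    points are in [F]. *)
Lemma ray_exit (R : realType) (E : normedModType R) (F : set E) (p d : E) (s : R) :
  closed F -> F° p -> 0 <= s -> ~ F (p + s *: d) ->
  exists2 t, 0 < t & (F `\` F°) (p + t *: d).
Proof.
move=> Fcl Fp s0 Fs; pose f (u : R) := p + u *: d.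
have fcont : continuous f.
  by move=> u; apply: cvgD; [exact: cvg_cst | apply: cvgZr_tmp; exact: cvg_id].
pose A := [set u | 0 <= u /\ ~ F° (f u)].
have A0 : lbound A 0 by move=> u [].
have Ainf : has_inf A by split; [exists s; split => // /interior_subset|exists 0].
have i0 : 0 <= inf A by apply: lb_le_inf => //; case: Ainf.
have below u : 0 <= u -> u < inf A -> F° (f u).
  move=> u0 ui; apply: contrapT => Fu; move: ui; rewrite ltNge.
  by rewrite ge_inf//; case: Ainf.
have near_inf (U : set E) : open U -> U (f (inf A)) ->
    exists2 e, 0 < e & forall u, `|inf A - u| < e -> U (f u).
  move=> Uo Ui; have /fcont : nbhs (f (inf A)) U by exact: open_nbhs_nbhs.
  by move=> /nbhs_ballP[e e0 eU]; exists e => // u ue; exact: eU.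
have Fi : ~ F° (f (inf A)).
  move=> /near_inf[]; first exact: open_interior.
  move=> e e0 eF; have [u Au ui] := inf_adherent e0 Ainf.
  have iu : inf A <= u by apply: ge_inf => //; case: Ainf.
  case: Au => _; apply; apply: eF.
  by rewrite distrC ger0_norm ?subr_ge0// ltrBlDl.
have {}i0 : 0 < inf A.
  rewrite lt_neqAle i0 andbT; apply/eqP => i0'; apply: Fi.
  by rewrite /f -i0' scale0r addr0.
exists (inf A) => //; split => //; apply: contrapT => nF.
have [] := near_inf (~` F) _ nF; first exact: closed_openC.
(* Going back by [w / 2] stays within [e] of the infimum and at a nonnegative time, so the point
   would be both outside [F] and in its interior. *)
move=> e e0 eF; pose w := Num.min e (inf A).
have w0 : 0 < w by rewrite lt_min e0.
have we : w <= e by rewrite ge_min lexx.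
have wi : w <= inf A by rewrite ge_min lexx orbT.
apply: (eF (inf A - w / 2)); last first.
  by apply: interior_subset; apply: below; lra.
by rewrite subKr ger0_norm; lra.
Qed.

(* The dimension n >= 1 of the source is n.+1 here, and its last index is
   ord_max. *)
Theorem proposition5p1 (R : realType) (n : nat)
    (g : 'I_n.+1 -> R -> R) (m h : 'cV[R]_n.+1) (r q gamma : R)
    (a : 'I_n.+1 -> 'cV[R]_n.+1) (alpha : 'I_n.+1 -> R)
    (g_convex : forall i, convex_function setT (g i : R^o -> R^o))
    (gamma_ge0 : 0 <= gamma)
    (a_neq0 : a ord_max <> 0)
    (a_orth : forall i j, i <> j -> dot (a i) (a j) = 0)
    (alpha_ge0 : forall i, 0 <= alpha i)
    (alpha_neq0 : alpha ord_max <> 0)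
    (alpha_max : forall i, alpha i <= alpha ord_max) :
  let G := fun x : 'cV[R]_n.+1 =>
    \sum_(i < n.+1) g i (dot (a i) x) + dot m x + r in
  let J := fun x : 'cV[R]_n.+1 =>
    - (\sum_(i < n.+1) alpha i * g i (dot (a i) x)) - dot h x - q in
  let B := epi G in
  let F := [set p : ('cV[R]_n.+1 * R^o)%type | gamma * p.2 <= J p.1] in
  let W := fun x : 'cV[R]_n.+1 =>
    (G x + (alpha ord_max)^-1 * J x) / (1 + gamma / alpha ord_max) in
  0 < 1 + gamma / alpha ord_max ->
  - (alpha ord_max * g ord_max (s * dot (a ord_max) (a ord_max)))
    - s * (dot h (a ord_max)
           + gamma * (dot (m - (alpha ord_max)^-1 *: h) (a ord_max)
                      / (1 + gamma / alpha ord_max)))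
    @[s --> norm_pinfty_nbhs R] --> -oo ->
  [/\ convex_hull (B `\` F°)
        = convex_hull [set p | epi G p /\ J p.1 <= gamma * p.2],
      convex_hull [set p | epi G p /\ J p.1 <= gamma * p.2]
        = epi G `&` epi W &
      forall x, W x =
        (\sum_(i < n.+1 | (i < n)%N)
            (1 - alpha i / alpha ord_max) * g i (dot (a i) x)
          + dot (m - (alpha ord_max)^-1 *: h) x + (r - q / alpha ord_max))
        / (1 + gamma / alpha ord_max)].
Proof.
set al := alpha ord_max; set an := a ord_max; set gn := g ord_max.
move=> G J B F W k0 lim_infty.
have al0 : 0 < al by rewrite lt_neqAle alpha_ge0 andbT eq_sym; apply/eqP.
have aln : al != 0 by rewrite gt_eqF.
set k := 1 + gamma / al in W k0 lim_infty *.
have kn : k != 0 by rewrite gt_eqF.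
pose c := dot (m - al^-1 *: h) an / k.
pose w x := \sum_(i < n.+1 | (i < n)%N) (1 - alpha i / al) * g i (dot (a i) x)
  + dot (m - al^-1 *: h) x + (r - q / al).
have lt_max (i : 'I_n.+1) : (i < n)%N = (i != ord_max).
  by rewrite -val_eqE /= ltn_neqAle -ltnS ltn_ord andbT.
(* The last summand has coefficient [1 - al^-1 * al = 0], so [g ord_max] disappears from [W]. *)
have WE x : W x = w x / k.
  rewrite /W; congr (_ / k); rewrite /G /J /w dotBZl.
  rewrite (eq_bigl _ _ lt_max) (bigD1 ord_max)//=.
  rewrite [in X in _ + _ * X](bigD1 ord_max)//= -/al -/gn -/an.
  rewrite [in RHS](eq_bigr (fun i => g i (dot (a i) x)
    - al^-1 * (alpha i * g i (dot (a i) x)))); last by move=> i _; ring.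
  by rewrite sumrB -mulr_sumr; field.
(* By orthogonality, a move along [an] is seen only by the last summand and the linear terms. *)
have dot_line i x s : i != ord_max -> dot (a i) (x + s *: an) = dot (a i) x.
  by move=> /eqP iN; rewrite dotDr dotZr a_orth// mulr0 addr0.
have W_line x s : W (x + s *: an) = W x + s * c.
  rewrite !WE /c mulrA -mulrDl; congr (_ / k); rewrite /w.
  under eq_bigr => i iN do rewrite dot_line -?lt_max//.
  by rewrite dotDr dotZr; ring.
have J_line x s : J (x + s *: an) = J x + al * gn (dot an x)
    - al * gn (dot an x + s * dot an an) - s * dot h an.
  rewrite /J (bigD1 ord_max)//= [in RHS](bigD1 ord_max)//= -/al -/gn -/an.
  under eq_bigr => i iN do rewrite dot_line//.
  by rewrite !dotDr !dotZr; ring.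
pose psi (p : 'cV[R]_n.+1 * R^o) := J p.1 - gamma * p.2.
have J_cont : continuous J.
  apply: continuous_subr; last by move=> x; exact: cst_continuous.
  apply: continuous_subr; last exact: continuous_dot.
  move=> x; apply: continuousN; move: x.
  apply: continuous_big => [|i _ y]; first exact: add_continuous.
  apply: (@continuous_comp _ _ _ (fun z => g i (dot (a i) z))).
    apply: continuous_comp; first exact: continuous_dot.
    exact: convex_continuous.
  exact: mulrl_continuous.
have psi_cont : continuous psi.
  apply: continuous_subr => p.
    by apply: continuous_comp; [exact: cvg_fst | exact: J_cont].
  apply: (@continuous_comp _ _ _ snd); first exact: cvg_snd.
  exact: mulrl_continuous.
have FE : F = psi @^-1` [set y | 0 <= y].
  by apply/seteqP; split => p; rewrite /F /psi /= subr_ge0.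
have F_closed : closed F.
  by rewrite FE; apply: preimage_closed => [p _|]; [exact: psi_cont|exact: closed_ge].
have sub_FI p : gamma * p.2 < J p.1 -> F° p.
  rewrite -subr_gt0 => Jp.
  suff : psi @^-1` [set y | 0 < y] `<=` F° by apply.
  rewrite -open_subsetE; first by rewrite FE => y /=; exact: ltW.
  by apply: open_comp => [? _|]; [exact: psi_cont | exact: open_gt].
(* Since [al * k = al + gamma], clearing denominators turns membership in [epi W] into the sum of
   [al] times [G <= t] and of [J <= gamma * t]. *)
have epiW p : W p.1 <= p.2 <-> al * G p.1 + J p.1 <= (al + gamma) * p.2.
  rewrite /W ler_pdivrMr// -(ler_pM2l al0).
  rewrite (_ : al * (_ + _) = al * G p.1 + J p.1); last by field.
  by rewrite (_ : al * (_ * _) = (al + gamma) * p.2)//; rewrite /k; field.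
have G_conv : convex_function setT (G : _ -> R^o).
  rewrite (_ : G = fun x => \sum_(i < n.+1) 1 * g i (dot (a i) x) + dot m x + r).
    by apply: convex_affine_sum.
  by apply/funext => x; rewrite /G; under [in RHS]eq_bigr do rewrite mul1r.
have w_conv : convex_function setT (w : _ -> R^o).
  apply: convex_affine_sum => // i _.
  by rewrite subr_ge0 ler_pdivrMr// mul1r alpha_max.
have EW_conv : convex_set (epi G `&` epi W).
  have cG := convex_epi G_conv.
  have := convex_epi_div k0 w_conv.
  rewrite (_ : (fun x => w x / k) = W); last by apply/funext => x; rewrite WE.
  move=> cW x y l; rewrite !inE => -[xG xW] [yG yW].
  by split; apply/set_mem; [apply: cG|apply: cW]; exact: mem_set.
(* The argument of [gn] on the line is [(s + v) * dot an an], so the limit is applied at [s + v].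
   The term [v * K] in the threshold makes up for this shift in the linear part, and [|v|] in the
   bound on [|s|] ensures [M < |s + v|]. *)
have far (p : 'cV[R]_n.+1 * R^o) : exists N : R, forall s : R, N < `|s| -> ~ F (p + s *: ((an, c) : _ * R^o)).
  case: p => x t; pose v := dot an x / dot an an.
  have DD : dot an an != 0 by rewrite gt_eqF// dot_gt0.
  pose K := dot h an + gamma * c.
  have /cvgrNyPlt/(_ (- (psi (x, t) + al * gn (dot an x)) - v * K))[M _ HM] := lim_infty.
  exists (`|M| + `|v|) => s Ns; apply/negP; rewrite -ltNge -subr_lt0 /=.
  have /HM /= : M < `|s + v|.
    have := lerB_normD s v; have := ler_norm M; lra.
  rewrite -/K J_line mulrDl divfK// [dot an x + _]addrC /psi /= /K.
  have -> : gamma * (t + s *: c) = gamma * t + s * (gamma * c).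
    by rewrite /GRing.scale /=; ring.
  lra.
set S := [set p | epi G p /\ J p.1 <= gamma * p.2].
have BFS : B `\` F° `<=` S.
  by move=> p [Bp Fp]; split => //; rewrite leNgt; apply/negP => /sub_FI.
have hull_mono : convex_hull (B `\` F°) `<=` convex_hull S.
  by move=> p hp C [Cc SC]; apply: hp; split => //; exact: subset_trans SC.
have S_sub : convex_hull S `<=` epi G `&` epi W.
  apply: smallest_sub => // p [Gp Jp]; split => //; apply/epiW.
  rewrite mulrDl; apply: lerD => //.
  by rewrite ler_pM2l.
have sub_hull : epi G `&` epi W `<=` convex_hull (B `\` F°).
  move=> p [Gp Wp].
  have [Fp|Fp] := pselect (F° p); last by apply: sub_gen_smallest.
  (* Subtracting [gamma * t <= J] from the cleared form of [W <= t] leaves [al * G <= al * t]. *)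
  have line_B (u : R) :
      F (p + u *: ((an, c) : _ * R^o)) -> B (p + u *: ((an, c) : _ * R^o)).
    rewrite /F /B /epi /= => Fu.
    have : W (p.1 + u *: an) <= p.2 + u * c by rewrite W_line lerD2r.
    move=> /(epiW (p.1 + u *: an, p.2 + u * c : R^o)) /= Wu.
    rewrite -(ler_pM2l al0) -(lerD2r (gamma * (p.2 + u * c))) -mulrDl.
    by apply: le_trans Wu; rewrite lerD2l.
  have [N farN] := far p.
  pose s := `|N| + 1.
  have s0 : 0 <= s by rewrite addr_ge0.
  have Ns : N < s by rewrite (le_lt_trans (ler_norm N))// ltrDl.
  have exitB e : `|e| = 1 ->
      exists2 t, 0 < t & (B `\` F°) (p + t *: (e *: ((an, c) : _ * R^o))).
    move=> e1.
    have Fs : ~ F (p + s *: (e *: ((an, c) : _ * R^o))).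
      by rewrite scalerA; apply: farN; rewrite normrM e1 mulr1 ger0_norm.
    have [t t0 [Ft FIt]] := ray_exit F_closed Fp s0 Fs.
    exists t => //; split => //.
    by move: Ft; rewrite scalerA; exact: line_B.
  have [t1 t10 Bt1] := exitB 1 (normr1 _).
  have [t2 t20 Bt2] := exitB (-1) (normrN1 _).
  move: Bt1 Bt2; rewrite scale1r scaleN1r => Bt1 Bt2.
  exact: convex_hull_between t10 t20 Bt1 Bt2.
(* The inclusions [hull_mono], [S_sub] and [sub_hull] form a cycle, so the three sets coincide. *)
split; last exact: WE.
- by apply/seteqP; split => // p /S_sub /sub_hull.
- by apply/seteqP; split => // p /sub_hull /hull_mono.
Qed.
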